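(* Let $A,B\in\mathrm{ASM}(n)$. Then $A$ covers $B$ in strong order if and only if $\Phi(A)$ can be obtained from $\Phi(B)$ by applying one of the following $16$ local moves. Each move changes only the tiles in a $2\times 2$ block of cells in two consecutive rows and two consecutive columns, with cells top-left (TL), top-right (TR), bottom-left (BL), bottom-right (BR). The move is applicable when TL is an r-tile or a cross, TR is a j-tile or a horizontal tile, BL is a vertical tile or a j-tile, and BR is blank or an r-tile (the $2^4=16$ combinations of these choices give the $16$ moves), and it replaces the tiles by \[ \begin{array}{ll} \text{TL:} & \text{r-tile}\mapsto\text{blank},\quad \text{cross}\mapsto\text{j-tile};\\ \text{TR:} & \text{j-tile}\mapsto\text{vertical},\quad \text{horizontal}\mapsto\text{r-tile};\\ \text{BL:} & \text{vertical}\mapsto\text{r-tile},\quad \text{j-tile}\mapsto\text{horizontal};\\ \text{BR:} & \text{blank}\mapsto\text{j-tile},\quad \text{r-tile}\mapsto\text{cross}. \end{array} \]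
   Context: $[n]=\{1,\dots,n\}$. An $n\times n$ alternating sign matrix (ASM) is a matrix $A=(A_{i,j})$ with entries in $\{-1,0,1\}$ such that $\sum_{j=1}^m A_{i,j}\in\{0,1\}$ for all $i,m\in[n]$, $\sum_{i=1}^m A_{i,j}\in\{0,1\}$ for all $j,m\in[n]$, and the sum of all entries is $n$; $\mathrm{ASM}(n)$ is the set of these. The corner sum function of $A$ is $\mathrm{rk}_A(i,j)=\sum_{a\in[i],\,b\in[j]}A_{a,b}$. Strong order on $\mathrm{ASM}(n)$: $A\le B$ iff $\mathrm{rk}_A(i,j)\ge \mathrm{rk}_B(i,j)$ for all $i,j\in[n]$. Bumpless pipe dreams: in an $n\times n$ grid with matrix coordinates (row 1 on top), fill each cell with one of six tiles, each determined by which of the midpoints of its edges Left, Right, Top, Bottom are met by pipe segments: blank (none), horizontal (L,R), vertical (T,B), cross (L,R,T,B; a horizontal and a vertical segment crossing), the ''r-tile'' (an elbow joining B and R), and the ''j-tile'' (an elbow joining L and T). A bumpless pipe dream is such a tiling forming a network of exactly $n$ pipes, each starting at the bottom edge of the grid and exiting at the right edge. $\mathrm{BPD}(n)$ is the set of these. There is a bijection $\mathrm{BPD}(n)\to\mathrm{ASM}(n)$ sending $\mathcal B$ to the matrix with entry $1$ at the r-tiles, $-1$ at the j-tiles, and $0$ elsewhere; $\Phi:\mathrm{ASM}(n)\to\mathrm{BPD}(n)$ denotes the inverse bijection. *)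

(* Defs.v *)
From HB Require Import structures.
From mathcomp Require Import all_boot all_order all_algebra.
From Stdlib Require Import ClassicalEpsilon.
Set Implicit Arguments.
Unset Strict Implicit.
Unset Printing Implicit Defensive.
Import Order.TTheory GRing.Theory Num.Theory.
Local Open Scope ring_scope.

(* Rows and columns are indexed by 'I_n, so index i stands for i + 1 in [n];   *)
(* row 0 is the top row.                                                      *)

Definition is_asm (n : nat) (A : 'M[int]_n) : Prop :=
  [/\ forall i j : 'I_n, A i j \in [:: -1; 0; 1],
      forall i m : 'I_n, \sum_(j < n | (j <= m)%N) A i j \in [:: 0; 1],
      forall j m : 'I_n, \sum_(i < n | (i <= m)%N) A i j \in [:: 0; 1] &
      \sum_(i < n) \sum_(j < n) A i j = n%:R].

Definition corner_sum (n : nat) (A : 'M[int]_n) (i j : 'I_n) : int :=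
  \sum_(a < n | (a <= i)%N) \sum_(b < n | (b <= j)%N) A a b.

Definition strong_le (n : nat) (A B : 'M[int]_n) : Prop :=
  forall i j : 'I_n, corner_sum B i j <= corner_sum A i j.

Definition strong_lt (n : nat) (A B : 'M[int]_n) : Prop :=
  strong_le A B /\ A <> B.

(* [covers A B] reads "A covers B" in the strong order on ASM(n).             *)
Definition covers (n : nat) (A B : 'M[int]_n) : Prop :=
  strong_lt B A /\
  ~ (exists C : 'M[int]_n, [/\ is_asm C, strong_lt B C & strong_lt C A]).

Inductive tile : Type :=
  Blank | Horizontal | Vertical | Cross | RTile | JTile.

Inductive side : Type := Left | Right | Top | Bottom.

Definition side_code (s : side) : bool * bool :=
  match s with
  | Left => (false, false) | Right => (false, true)
  | Top => (true, false) | Bottom => (true, true)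
  end.

Definition side_decode (c : bool * bool) : side :=
  match c with
  | (false, false) => Left | (false, true) => Right
  | (true, false) => Top | (true, true) => Bottom
  end.

Lemma side_codeK : cancel side_code side_decode.
Proof. by case. Qed.

HB.instance Definition _ := Equality.copy side (can_type side_codeK).

Definition tiling (n : nat) : Type := 'M[tile]_n.

(* The pipe segments of a tile, as (entry side, exit side). A pipe followed   *)
(* from the bottom edge of the grid can only travel up or to the right, so    *)
(* these are the only orientations in which a segment is ever traversed.      *)
Definition tile_segments (t : tile) : seq (side * side) :=
  match t with
  | Blank => [::]
  | Horizontal => [:: (Left, Right)]
  | Vertical => [:: (Bottom, Top)]
  | Cross => [:: (Left, Right); (Bottom, Top)]
  | RTile => [:: (Bottom, Right)]
  | JTile => [:: (Left, Top)]
  end.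

(* ((row, column), (entry side, exit side))                                   *)
Definition segment (n : nat) : Type := (('I_n * 'I_n) * (side * side))%type.

Definition segment_of (n : nat) (P : tiling n) (s : segment n) : bool :=
  s.2 \in tile_segments (P s.1.1 s.1.2).

(* [t] enters its cell through the very edge by which [s] leaves its own.     *)
Definition followed_by (n : nat) (s t : segment n) : bool :=
  match s.2.2, t.2.1 with
  | Right, Left => (t.1.1 == s.1.1) && (t.1.2 == s.1.2.+1 :> nat)
  | Top, Bottom => (s.1.1 == t.1.1.+1 :> nat) && (t.1.2 == s.1.2)
  | _, _ => false
  end.

Definition starts_at_bottom_edge (n : nat) (s : segment n) : bool :=
  (s.1.1.+1 == n) && (s.2.1 == Bottom).

Definition exits_at_right_edge (n : nat) (s : segment n) : bool :=
  (s.1.2.+1 == n) && (s.2.2 == Right).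

Definition is_pipe (n : nat) (P : tiling n) (p : seq (segment n)) : bool :=
  if p is s :: q then
    [&& all (segment_of P) p, path (@followed_by n) s q,
        starts_at_bottom_edge s & exits_at_right_edge (last s q)]
  else false.

(* Any two pipes are disjoint, and together they use up all pipe segments.    *)
Definition is_bpd (n : nat) (P : tiling n) : Prop :=
  exists p : 'I_n -> seq (segment n),
    (forall k : 'I_n, is_pipe P (p k)) /\
    (forall s : segment n, segment_of P s -> exists! k : 'I_n, s \in p k).

Definition tiling_mx (n : nat) (P : tiling n) : 'M[int]_n :=
  \matrix_(i, j) match P i j with RTile => 1 | JTile => -1 | _ => 0 end.

(* For A in ASM(n) there is exactly one bumpless pipe dream with matrix A, so *)
(* on ASM(n) this is the inverse of the bijection [tiling_mx] from BPD(n) to  *)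
(* ASM(n). Its values at other matrices are irrelevant.                       *)
Definition Phi (n : nat) (A : 'M[int]_n) : tiling n :=
  epsilon (inhabits (const_mx Blank : tiling n))
    (fun P : tiling n => is_bpd P /\ tiling_mx P = A).

Inductive move_TL : tile -> tile -> Prop :=
  | move_TL_r : move_TL RTile Blank
  | move_TL_cross : move_TL Cross JTile.

Inductive move_TR : tile -> tile -> Prop :=
  | move_TR_j : move_TR JTile Vertical
  | move_TR_horizontal : move_TR Horizontal RTile.

Inductive move_BL : tile -> tile -> Prop :=
  | move_BL_vertical : move_BL Vertical RTile
  | move_BL_j : move_BL JTile Horizontal.

Inductive move_BR : tile -> tile -> Prop :=
  | move_BR_blank : move_BR Blank JTile
  | move_BR_r : move_BR RTile Cross.

(* [local_move P Q]: one of the 16 moves turns P into Q, acting on the block  *)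
(* with rows i, i' = i + 1 and columns j, j' = j + 1.                         *)
Definition local_move (n : nat) (P Q : tiling n) : Prop :=
  exists i i' j j' : 'I_n,
    [/\ i' = i.+1 :> nat, j' = j.+1 :> nat,
        [/\ move_TL (P i j) (Q i j), move_TR (P i j') (Q i j'),
            move_BL (P i' j) (Q i' j) & move_BR (P i' j') (Q i' j')] &
        forall a b : 'I_n,
          ~~ ((a \in [:: i; i']) && (b \in [:: j; j'])) -> Q a b = P a b].

(* Main.v *)
Require Import Defs.
From mathcomp Require Import all_boot all_order all_algebra.
From mathcomp Require Import zify.
From Stdlib Require Import ClassicalEpsilon.

(** A bumpless pipe dream is a picture of the prefix sums of its matrix: an
    r-tile creates, and a j-tile destroys, both a horizontal segment (read left
    to right) and a vertical one (read top to bottom), and no other tile changes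
    either.  Since no pipe touches the left or top edge of the grid, the tile in
    cell (i, j) meets its right side exactly when the entries of row i up to
    column j add up to 1, meets its bottom side exactly when the entries of
    column j down to row i add up to 1, and similarly for the other two sides
    ([linked_draws]).  A tile is determined by the sides that it meets, so there
    is at most one bumpless pipe dream with a given matrix.  Conversely, for an
    alternating sign matrix these prefix sums are 0 or 1 and prescribe a tile
    everywhere; in the resulting tiling every segment has a unique continuation
    and a unique origin, until the right, respectively bottom, edge is reached.
    Following segments in both directions gives n disjoint pipes that use every
    segment ([asm_draws_bpd]).  Hence Phi A is the tiling given by the prefix
    sums of A ([Phi_draws]).

    Prefix sums are differences of the corner sums rk(x, y).  Reading them off,
    the 16 local moves are exactly the ways in which the four tiles around an
    interior lattice point can change when the corner sum at that point drops by
    one and all the others stay the same ([draws_local_move]).  So the theorem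
    says that covers in strong order are the one-point drops of the corner sum
    function ([covers_rk_drop]).  A one-point drop is a cover because corner sums
    are integers and determine the matrix.  For the converse it is enough to
    find, whenever A is strictly above B, a one-point drop of B that is still
    below A.  Corner sum functions of alternating sign matrices are those with
    unit steps 0 or 1 and the value n at (n, n), so rk_B may be lowered at a
    point as soon as its steps into the point are both 1 and its steps out of
    the point are both 0.  Among the points where rk_A < rk_B, one that maximizes
    2 rk_B(x, y) - (x + y) has this property: if it failed, the neighbour in the
    offending direction would also satisfy rk_A < rk_B, and have a larger value
    ([asm_lt_descent]). *)

Set Implicit Arguments.
Unset Strict Implicit.
Unset Printing Implicit Defensive.
Import Order.TTheory GRing.Theory Num.Theory.
Local Open Scope ring_scope.

(** * Prefix sums and corner sums *)

Definition row_prefix (n : nat) (A : 'M[int]_n) (i : 'I_n) (m : nat) : int :=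
  \sum_(b < n | (b < m)%N) A i b.

Definition col_prefix (n : nat) (A : 'M[int]_n) (j : 'I_n) (m : nat) : int :=
  \sum_(a < n | (a < m)%N) A a j.

(** The corner sum indexed by the lattice points of the grid, so that x and y
    count rows and columns and the boundary values x = 0 and y = 0 exist. *)
Definition rk (n : nat) (A : 'M[int]_n) (x y : nat) : int :=
  \sum_(a < n | (a < x)%N) row_prefix A a y.

Lemma sum_ltS (n : nat) (F : 'I_n -> int) (i : 'I_n) :
  \sum_(a < n | (a < i.+1)%N) F a = \sum_(a < n | (a < i)%N) F a + F i.
Proof.
rewrite (bigD1 i) //= addrC; congr (_ + _); apply: eq_bigl => a.
by rewrite -val_eqE /=; lia.
Qed.

Lemma sum_lt0 (n : nat) (F : 'I_n -> int) : \sum_(a < n | (a < 0)%N) F a = 0.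
Proof. by rewrite big_pred0. Qed.

Section CornerSums.

Variables (n : nat).
Implicit Types A B : 'M[int]_n.

Lemma row_prefix0 A i : row_prefix A i 0 = 0.
Proof. exact: sum_lt0. Qed.

Lemma col_prefix0 A j : col_prefix A j 0 = 0.
Proof. exact: sum_lt0. Qed.

Lemma row_prefixS A (i j : 'I_n) :
  row_prefix A i j.+1 = row_prefix A i j + A i j.
Proof. exact: sum_ltS. Qed.

Lemma col_prefixS A (i j : 'I_n) :
  col_prefix A j i.+1 = col_prefix A j i + A i j.
Proof. exact: sum_ltS. Qed.

Lemma rk0x A y : rk A 0 y = 0.
Proof. exact: sum_lt0. Qed.

Lemma rkE A x y : rk A x y = \sum_(b < n | (b < y)%N) col_prefix A b x.
Proof. by rewrite /rk /row_prefix exchange_big. Qed.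

Lemma rkx0 A x : rk A x 0 = 0.
Proof. by rewrite rkE sum_lt0. Qed.

Lemma rkSx A (i : 'I_n) y : rk A i.+1 y = rk A i y + row_prefix A i y.
Proof. exact: sum_ltS. Qed.

Lemma rkxS A x (j : 'I_n) : rk A x j.+1 = rk A x j + col_prefix A j x.
Proof. by rewrite !rkE sum_ltS. Qed.

(** An entry is a second difference of corner sums. *)
Lemma rk_inj A B :
  (forall x y, (x <= n)%N -> (y <= n)%N -> rk A x y = rk B x y) -> A = B.
Proof.
move=> eq_rk; apply/matrixP => i j; have := (ltn_ord i, ltn_ord j).
case=> lin ljn.
have rowE m : (m <= n)%N -> row_prefix A i m = row_prefix B i m.
  move=> lmn; have := rkSx A i m; have := rkSx B i m.
  by rewrite !eq_rk //; [lia | exact: ltnW].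
have := row_prefixS A i j; have := row_prefixS B i j.
by rewrite !rowE //; [lia | exact: ltnW].
Qed.

(** Every function vanishing on the two axes is a corner sum function; this is
    how a matrix is produced from modified corner sums. *)
Lemma rk_mixed_difference (f : nat -> nat -> int) :
    (forall y, f 0 y = 0) -> (forall x, f x 0 = 0) ->
  forall x y, (x <= n)%N -> (y <= n)%N ->
  rk (\matrix_(i < n, j < n)
        (f i.+1 j.+1 - f i j.+1 - f i.+1 j + f i j)) x y = f x y.
Proof.
move=> f0y fx0; set M := (X in rk X).
have rowE (i : 'I_n) y : (y <= n)%N -> row_prefix M i y = f i.+1 y - f i y.
  elim: y => [|y IHy] lyn; first by rewrite row_prefix0 !fx0.
  by rewrite (row_prefixS M i (Ordinal lyn)) IHy 1?ltnW // mxE /=; lia.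
elim=> [|x IHx] y lxn lyn; first by rewrite rk0x f0y.
rewrite (rkSx M (Ordinal lxn)) IHx ?(ltnW lxn) // rowE //=; lia.
Qed.

Lemma corner_sumE A (i j : 'I_n) : corner_sum A i j = rk A i.+1 j.+1.
Proof. by []. Qed.

Lemma bitP (x : int) : reflect (0 <= x <= 1) (x \in [:: 0; 1]).
Proof. by rewrite !inE; apply: (iffP idP); lia. Qed.

Lemma asm_row_prefix A i m : is_asm A -> (m <= n)%N ->
  0 <= row_prefix A i m <= 1.
Proof.
case=> _ rowA _ _; case: m => [|m] lmn; first by rewrite row_prefix0.
exact/bitP/(rowA i (Ordinal lmn)).
Qed.

Lemma asm_col_prefix A j m : is_asm A -> (m <= n)%N ->
  0 <= col_prefix A j m <= 1.
Proof.
case=> _ _ colA _; case: m => [|m] lmn; first by rewrite col_prefix0.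
exact/bitP/(colA j (Ordinal lmn)).
Qed.

Lemma asm_rk_total A : is_asm A -> rk A n n = n%:Z.
Proof.
case=> _ _ _ totA; rewrite -[RHS]natz -totA.
rewrite /rk; apply: eq_big => [i|i _]; first exact: ltn_ord.
by apply: eq_bigl => j; rewrite ltn_ord.
Qed.

Lemma asm_rk_row A x y : is_asm A -> (x < n)%N -> (y <= n)%N ->
  rk A x y <= rk A x.+1 y <= rk A x y + 1.
Proof.
move=> hA lxn lyn; rewrite (rkSx A (Ordinal lxn)) /=.
by have := asm_row_prefix (Ordinal lxn) hA lyn; lia.
Qed.

Lemma asm_rk_col A x y : is_asm A -> (x <= n)%N -> (y < n)%N ->
  rk A x y <= rk A x y.+1 <= rk A x y + 1.
Proof.
move=> hA lxn lyn; rewrite (rkxS A x (Ordinal lyn)) /=.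
by have := asm_col_prefix (Ordinal lyn) hA lxn; lia.
Qed.

(** Steps of at most 1 reach n in n steps only if every step is 1; this fixes the
    corner sums of an alternating sign matrix along the bottom and right edges. *)
Lemma unit_steps_forced (g : nat -> int) :
    g 0 = 0 -> g n = n%:Z -> (forall m, (m < n)%N -> g m.+1 <= g m + 1) ->
  forall m, (m <= n)%N -> g m = m%:Z.
Proof.
move=> g0 gn gS m lmn.
have upper : forall k, (k <= n)%N -> g k <= k%:Z.
  elim=> [|k IHk] lkn; first by rewrite g0.
  have := gS k lkn; have := IHk (ltnW lkn); lia.
have lower : forall k, (k <= n)%N -> (n - k)%N%:Z <= g (n - k)%N.
  elim=> [|k IHk] lkn; first by rewrite subn0 gn.
  have := IHk (ltnW lkn); have := gS (n - k.+1)%N.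
  by rewrite subnSK //; lia.
have := upper m lmn; have := lower _ (leq_subr m n); rewrite subKn //; lia.
Qed.

Lemma asm_rk_bottom A y : is_asm A -> (y <= n)%N -> rk A n y = y%:Z.
Proof.
move=> hA; apply: (unit_steps_forced (g := rk A n)).
- exact: rkx0.
- exact: asm_rk_total.
- by move=> m lmn; have := asm_rk_col hA (leqnn n) lmn; lia.
Qed.

Lemma asm_rk_right A x : is_asm A -> (x <= n)%N -> rk A x n = x%:Z.
Proof.
move=> hA; apply: (unit_steps_forced (g := rk A ^~ n)).
- exact: rk0x.
- exact: asm_rk_total.
- by move=> m lmn; have := asm_rk_row hA lmn (leqnn n); lia.
Qed.

Lemma asm_col_total A j : is_asm A -> col_prefix A j n = 1.
Proof.
move=> hA; have := rkxS A n j; rewrite !asm_rk_bottom //; [lia | exact: ltnW].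
Qed.

(** Together with [asm_rk_row], [asm_rk_col] and [asm_rk_total] this recognizes
    alternating sign matrices by their corner sums.  The entries
    lie in {-1, 0, 1} as differences of two prefix sums in {0, 1}. *)
Lemma is_asm_rk A :
    (forall x y, (x < n)%N -> (y <= n)%N ->
       rk A x y <= rk A x.+1 y <= rk A x y + 1) ->
    (forall x y, (x <= n)%N -> (y < n)%N ->
       rk A x y <= rk A x y.+1 <= rk A x y + 1) ->
    rk A n n = n%:Z -> is_asm A.
Proof.
move=> rowA colA totA.
have rowP i m : (m <= n)%N -> 0 <= row_prefix A i m <= 1.
  by move=> lmn; have := rowA i m (ltn_ord i) lmn; rewrite rkSx; lia.
have colP j m : (m <= n)%N -> 0 <= col_prefix A j m <= 1.
  by move=> lmn; have := colA m j lmn (ltn_ord j); rewrite rkxS; lia.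
split=> [i j|i m|j m|].
- have := rowP i _ (ltn_ord j); have := rowP i _ (ltnW (ltn_ord j)).
  by rewrite row_prefixS !inE; lia.
- exact/bitP/(rowP i _ (ltn_ord m)).
- exact/bitP/(colP j _ (ltn_ord m)).
- rewrite natz -totA; apply: eq_big => [i|i _]; first by rewrite ltn_ord.
  by apply: eq_bigl => j; rewrite ltn_ord.
Qed.

(** * Covers in strong order *)

Lemma strong_le_rk A B : strong_le A B ->
  forall x y, (x <= n)%N -> (y <= n)%N -> rk B x y <= rk A x y.
Proof.
move=> leAB [|x] y; first by rewrite !rk0x.
case: y => [|y] lxn lyn; first by rewrite !rkx0.
exact: (leAB (Ordinal lxn) (Ordinal lyn)).
Qed.

Lemma rk_strong_le A B :
    (forall x y, (x <= n)%N -> (y <= n)%N -> rk B x y <= rk A x y) ->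
  strong_le A B.
Proof. by move=> leAB i j; rewrite !corner_sumE leAB. Qed.

Definition rk_drop B A (x0 y0 : nat) : Prop :=
  forall x y, (x <= n)%N -> (y <= n)%N ->
    rk A x y = rk B x y - ((x == x0) && (y == y0))%:Z.

(** Nothing fits strictly between two integer functions that differ by 1 at one
    point only. *)
Lemma rk_drop_covers B A x0 y0 :
  (x0 <= n)%N -> (y0 <= n)%N -> rk_drop B A x0 y0 -> covers A B.
Proof.
move=> lx0n ly0n dropBA; split; first split.
- by apply: rk_strong_le => x y lxn lyn; rewrite dropBA //; lia.
- by move=> eqBA; have := dropBA _ _ lx0n ly0n; rewrite eqBA !eqxx; lia.
case=> C [_ [/strong_le_rk leBC neqBC] [/strong_le_rk leCA neqCA]].
have midC x y : (x <= n)%N -> (y <= n)%N -> rk A x y <= rk C x y <= rk B x y.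
  by move=> lxn lyn; rewrite leBC // leCA.
have away x y : (x <= n)%N -> (y <= n)%N -> ~~ ((x == x0) && (y == y0)) ->
    rk C x y = rk A x y /\ rk C x y = rk B x y.
  move=> lxn lyn nxy; have := midC x y lxn lyn; rewrite dropBA // (negPf nxy).
  by lia.
have [rkC0|rkC0] : rk C x0 y0 = rk B x0 y0 \/ rk C x0 y0 = rk A x0 y0.
  by have := midC _ _ lx0n ly0n; rewrite dropBA // !eqxx; lia.
- apply: neqBC; apply: rk_inj => x y lxn lyn.
  case: (boolP ((x == x0) && (y == y0))) => [/andP[/eqP-> /eqP->]//|nxy].
  by case: (away x y lxn lyn nxy).
- apply: neqCA; apply: rk_inj => x y lxn lyn.
  case: (boolP ((x == x0) && (y == y0))) => [/andP[/eqP-> /eqP->]//|nxy].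
  by case: (away x y lxn lyn nxy).
Qed.

(** The four conditions say that the unit steps of rk into the point
    (x0 + 1, y0 + 1) are 1 and those out of it are 0, so lowering rk there by 1
    turns the former into 0 and the latter into 1. *)
Lemma asm_rk_drop_exists B x0 y0 : is_asm B ->
    (x0.+1 < n)%N -> (y0.+1 < n)%N ->
    rk B x0 y0.+1 < rk B x0.+1 y0.+1 -> rk B x0.+1 y0 < rk B x0.+1 y0.+1 ->
    rk B x0.+2 y0.+1 <= rk B x0.+1 y0.+1 ->
    rk B x0.+1 y0.+2 <= rk B x0.+1 y0.+1 ->
  exists2 C, is_asm C & rk_drop B C x0.+1 y0.+1.
Proof.
move=> hB lx0n ly0n up left down right.
pose f x y := rk B x y - ((x == x0.+1) && (y == y0.+1))%:Z.
have [C rkC] : exists C : 'M[int]_n, forall x y,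
    (x <= n)%N -> (y <= n)%N -> rk C x y = f x y.
  have f0y y : f 0 y = 0 by rewrite /f rk0x.
  have fx0 x : f x 0 = 0 by rewrite /f rkx0 andbF.
  by eexists; exact: rk_mixed_difference f0y fx0.
exists C => //; apply: is_asm_rk => [x y lxn lyn|x y lxn lyn|].
- rewrite !rkC // 1?ltnW // /f; have := asm_rk_row hB lxn lyn.
  have [->|ny] := eqVneq y y0.+1; last by rewrite !andbF; lia.
  have [->|nx] := eqVneq x x0.+1; first by rewrite !andbT; lia.
  have [->|nx'] := eqVneq x x0; first by rewrite eqxx; lia.
  by rewrite eqSS (negPf nx'); lia.
- rewrite !rkC // 1?ltnW // /f; have := asm_rk_col hB lxn lyn.
  have [->|nx] := eqVneq x x0.+1; last by lia.
  have [->|ny] := eqVneq y y0.+1; first by lia.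
  have [->|ny'] := eqVneq y y0; first by rewrite eqxx; lia.
  by rewrite eqSS (negPf ny'); lia.
- by rewrite rkC // /f asm_rk_total //; lia.
Qed.

(** A one-point drop of B that stays below A: if A covers B, it can only be A
    itself.  The point is found by maximizing a potential over the points where
    rk A and rk B differ. *)
Lemma asm_lt_descent B A : is_asm B -> is_asm A -> strong_lt B A ->
  exists x0 y0 C, [/\ (x0.+1 < n)%N, (y0.+1 < n)%N, is_asm C,
    rk_drop B C x0.+1 y0.+1 & strong_le C A].
Proof.
move=> hB hA [/strong_le_rk leBA neqBA].
pose above (p : 'I_n.+1 * 'I_n.+1) := rk A p.1 p.2 < rk B p.1 p.2.
(* A step out of the point of size 1 adds 2 - 1 to this potential, and going
   back along a step of size 0 into it adds 0 + 1; both lead to points of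
   [above].  So at a maximum neither kind of step occurs. *)
pose pot (p : 'I_n.+1 * 'I_n.+1) : int :=
  2 * rk B p.1 p.2 - (p.1 + p.2)%N%:Z.
have [p0 above0] : exists p, above p.
  case: (pickP above) => [p hp|none]; first by exists p.
  case: neqBA; apply: rk_inj => x y lxn lyn.
  have := none (Ordinal (lxn : (x < n.+1)%N), Ordinal (lyn : (y < n.+1)%N)).
  by rewrite /above /=; have := leBA x y lxn lyn; lia.
case: (@Order.TotalTheory.arg_maxP _ _ _ p0 above pot above0) => -[x y].
have := (ltn_ord x, ltn_ord y); case: x y => x /= lx [y /= ly] _.
rewrite /above /= => hxy maxp.
have best x' y' : (x' <= n)%N -> (y' <= n)%N -> rk A x' y' < rk B x' y' ->
    2 * rk B x' y' - (x' + y')%N%:Z <= 2 * rk B x y - (x + y)%N%:Z.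
  by move=> lx' ly' ab'; apply: (maxp (Ordinal (lx' : (x' < n.+1)%N),
                                       Ordinal (ly' : (y' < n.+1)%N))).
case: x => [|x0] in lx maxp hxy best *; first by rewrite !rk0x in hxy.
case: y => [|y0] in ly maxp hxy best *; first by rewrite !rkx0 in hxy.
(* On the bottom and right edges rk A and rk B agree, so the point is interior. *)
have lx0n : (x0.+1 < n)%N.
  rewrite ltn_neqAle -ltnS lx andbT; apply/eqP => xn; move: hxy.
  by rewrite xn !asm_rk_bottom ?ltxx.
have ly0n : (y0.+1 < n)%N.
  rewrite ltn_neqAle -ltnS ly andbT; apply/eqP => yn; move: hxy.
  by rewrite yn !asm_rk_right ?ltxx.
have [lx1 ly1] := (ltnW lx0n, ltnW ly0n).
have [lx2 ly2] := (ltnW lx1, ltnW ly1).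
(* In each direction: if the step of rk B were wrong, rk A, having steps in
   {0, 1} as well, would still be smaller than rk B at the neighbour. *)
have hup : rk B x0 y0.+1 < rk B x0.+1 y0.+1.
  have := best x0 y0.+1 lx2 ly1.
  by have := asm_rk_row hA lx1 ly1; have := asm_rk_row hB lx1 ly1; lia.
have hleft : rk B x0.+1 y0 < rk B x0.+1 y0.+1.
  have := best x0.+1 y0 lx1 ly2.
  by have := asm_rk_col hA lx1 ly1; have := asm_rk_col hB lx1 ly1; lia.
have hdown : rk B x0.+2 y0.+1 <= rk B x0.+1 y0.+1.
  have := best x0.+2 y0.+1 lx0n ly1.
  by have := asm_rk_row hA lx0n ly1; have := asm_rk_row hB lx0n ly1; lia.
have hright : rk B x0.+1 y0.+2 <= rk B x0.+1 y0.+1.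
  have := best x0.+1 y0.+2 lx1 ly0n.
  by have := asm_rk_col hA lx1 ly0n; have := asm_rk_col hB lx1 ly0n; lia.
have [C hC dropBC] := asm_rk_drop_exists hB lx0n ly0n hup hleft hdown hright.
exists x0, y0, C; split=> //; apply: rk_strong_le => x y lxn lyn.
rewrite dropBC //; have := leBA x y lxn lyn.
have [->|nx] := eqVneq x x0.+1; last by rewrite subr0.
have [->|ny] := eqVneq y y0.+1; last by rewrite subr0.
by move=> _; rewrite /=; lia.
Qed.

Lemma covers_rk_drop A B : is_asm A -> is_asm B ->
  covers A B <-> exists x0 y0,
    [/\ (x0.+1 < n)%N, (y0.+1 < n)%N & rk_drop B A x0.+1 y0.+1].
Proof.
move=> hA hB; split=> [[ltBA noC]|[x0 [y0 [lx0n ly0n dropBA]]]]; last first.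
  exact: rk_drop_covers (ltnW lx0n) (ltnW ly0n) dropBA.
have [x0 [y0 [C [lx0n ly0n hC dropBC leCA]]]] := asm_lt_descent hB hA ltBA.
have [ltBC _] := rk_drop_covers (ltnW lx0n) (ltnW ly0n) dropBC.
exists x0, y0; split=> //.
case: (eqVneq C A) => [<-//|/eqP neqCA].
by case: noC; exists C.
Qed.

End CornerSums.

(** * Sides of a tile

    A tile is crossed from Left or Bottom to Right or Top, so [enters] at Left
    and Bottom and [exits] at Right and Top tell which sides it meets. *)

Definition enters (t : tile) (d : side) : bool :=
  d \in unzip1 (tile_segments t).

Definition exits (t : tile) (d : side) : bool :=
  d \in unzip2 (tile_segments t).

Lemma entersP t d :
  reflect (exists d', (d, d') \in tile_segments t) (enters t d).
Proof.
by case: t d => - []; constructor; (by [eexists] || by [exists Left] ||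
  by [exists Right] || by [exists Top] || by case=> - []).
Qed.

Lemma exitsP t d :
  reflect (exists d', (d', d) \in tile_segments t) (exits t d).
Proof.
by case: t d => - []; constructor; (by [eexists] || by [exists Left] ||
  by [exists Right] || by [exists Bottom] || by case=> - []).
Qed.

Lemma exit_fun t d e e' :
  (d, e) \in tile_segments t -> (d, e') \in tile_segments t -> e = e'.
Proof. by case: t d e e' => - [] [] []. Qed.

Lemma entry_fun t d d' e :
  (d, e) \in tile_segments t -> (d', e) \in tile_segments t -> d = d'.
Proof. by case: t d e d' => - [] [] []. Qed.

Definition tile_sign (t : tile) : int :=
  match t with RTile => 1 | JTile => -1 | _ => 0 end.

(** Pipes turn only at r-tiles, which start a horizontal and a vertical segment,
    and at j-tiles, which end one of each. *)
Lemma tile_sign_row t : (exits t Right)%:Z = (enters t Left)%:Z + tile_sign t.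
Proof. by case: t. Qed.

Lemma tile_sign_col t : (enters t Bottom)%:Z = (exits t Top)%:Z + tile_sign t.
Proof. by case: t. Qed.

(** * Tilings drawn by prefix sums *)

Section Tilings.

Variable n : nat.
Implicit Types (A : 'M[int]_n) (P : tiling n) (s t : segment n).

Definition draws A P : Prop := forall i j : 'I_n,
  [/\ (enters (P i j) Left)%:Z = row_prefix A i j,
      (exits (P i j) Right)%:Z = row_prefix A i j.+1,
      (exits (P i j) Top)%:Z = col_prefix A j i &
      (enters (P i j) Bottom)%:Z = col_prefix A j i.+1].

(** The local content of [is_bpd]: every segment continues up to the right edge,
    and comes from the bottom edge. *)
Definition linked P : Prop :=
  (forall s, segment_of P s -> exits_at_right_edge s \/
     exists2 t, segment_of P t & followed_by s t) /\
  (forall t, segment_of P t -> starts_at_bottom_edge t \/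
     exists2 s, segment_of P s & followed_by s t).

Lemma draws_tiling_mx A P : draws A P -> tiling_mx P = A.
Proof.
move=> drawP; apply/matrixP => i j; rewrite mxE -/(tile_sign (P i j)).
have [pl pr _ _] := drawP i j; have := tile_sign_row (P i j).
by rewrite pl pr row_prefixS; lia.
Qed.

(** The six tiles realize all the side patterns l, t, l + a, t + a with values
    in {0, 1}. *)
Lemma asm_draws_exists A : is_asm A -> exists P, draws A P.
Proof.
move=> hA.
have /fin_all_exists[f drawf] : forall p : 'I_n * 'I_n, exists t : tile,
  [/\ (enters t Left)%:Z = row_prefix A p.1 p.2,
      (exits t Right)%:Z = row_prefix A p.1 p.2.+1,
      (exits t Top)%:Z = col_prefix A p.2 p.1 &
      (enters t Bottom)%:Z = col_prefix A p.2 p.1.+1].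
  case=> i j /=.
  have := asm_row_prefix i hA (ltn_ord j).
  have := asm_row_prefix i hA (ltnW (ltn_ord j)).
  have := asm_col_prefix j hA (ltn_ord i).
  have := asm_col_prefix j hA (ltnW (ltn_ord i)).
  rewrite row_prefixS col_prefixS.
  move: (row_prefix A i j) (col_prefix A j i) (A i j) => l t a ht hb hl hr.
  have [l0|l1] : l = 0 \/ l = 1 by lia.
  - have [t0|t1] : t = 0 \/ t = 1 by lia.
    + have [a0|a1] : a = 0 \/ a = 1 by lia.
        by exists Blank; rewrite l0 t0 a0.
      by exists RTile; rewrite l0 t0 a1.
    + by exists Vertical; split; rewrite /=; lia.
  - have [t0|t1] : t = 0 \/ t = 1 by lia.
    + by exists Horizontal; split; rewrite /=; lia.
    + have [a0|a1] : a = 0 \/ a = -1 by lia.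
        by exists Cross; rewrite l1 t1 a0.
      by exists JTile; rewrite l1 t1 a1.
by exists (\matrix_(i, j) f (i, j)) => i j; rewrite mxE; exact: (drawf (i, j)).
Qed.

Lemma segment_enters P (i j : 'I_n) d e :
  segment_of P ((i, j), (d, e)) -> enters (P i j) d.
Proof. by move=> h; apply/entersP; exists e. Qed.

Lemma segment_exits P (i j : 'I_n) d e :
  segment_of P ((i, j), (d, e)) -> exits (P i j) e.
Proof. by move=> h; apply/exitsP; exists d. Qed.

(** Adjacent cells read the same prefix sum on their common edge, and the empty
    prefix sums keep segments away from the left and top edges. *)
Lemma draws_linked A P : draws A P -> linked P.
Proof.
move=> drawP; split=> -[[i j] [d e]] segP.
- have := segment_exits segP; have [_ hR hT _] := drawP i j.
  case: e segP => segP; try by case: (P i j).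
  + rewrite /exits_at_right_edge /= eqxx andbT => exR.
    have [jn|jn] := eqVneq j.+1 n; [by left | right].
    have ljn : (j.+1 < n)%N by rewrite ltn_neqAle jn ltn_ord.
    have [hL _ _ _] := drawP i (Ordinal ljn).
    have /entersP[e' segt] : enters (P i (Ordinal ljn)) Left.
      by move: hL => /=; rewrite -hR exR; case: (enters _ _).
    by exists ((i, Ordinal ljn), (Left, e')) => //; rewrite /followed_by /= !eqxx.
  + move=> exT; right; case: i => -[|i] lin in segP hT exT hR *.
      by move: hT; rewrite col_prefix0 exT.
    have [_ _ _ hB] := drawP (Ordinal (ltnW lin)) j.
    have /entersP[e' segt] : enters (P (Ordinal (ltnW lin)) j) Bottom.
      by move: hB => /=; rewrite -hT exT; case: (enters _ _).
    exists ((Ordinal (ltnW lin), j), (Bottom, e')) => //.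
    by rewrite /followed_by /= !eqxx.
- have := segment_enters segP; have [hL _ _ hB] := drawP i j.
  case: d segP => segP; try by case: (P i j).
  + move=> enL; right; case: j => -[|j] ljn in segP hL enL hB *.
      by move: hL; rewrite row_prefix0 enL.
    have [_ hR _ _] := drawP i (Ordinal (ltnW ljn)).
    have /exitsP[d' segt] : exits (P i (Ordinal (ltnW ljn))) Right.
      by move: hR => /=; rewrite -hL enL; case: (exits _ _).
    exists ((i, Ordinal (ltnW ljn)), (d', Right)) => //.
    by rewrite /followed_by /= !eqxx.
  + rewrite /starts_at_bottom_edge /= eqxx andbT => enB.
    have [jn|jn] := eqVneq i.+1 n; [by left | right].
    have lin : (i.+1 < n)%N by rewrite ltn_neqAle jn ltn_ord.
    have [_ _ hT _] := drawP (Ordinal lin) j.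
    have /exitsP[d' segt] : exits (P (Ordinal lin) j) Top.
      by move: hT => /=; rewrite -hB enB; case: (exits _ _).
    by exists ((Ordinal lin, j), (d', Top)) => //; rewrite /followed_by /= !eqxx.
Qed.

(** Continuity across each edge, and the absence of pipes on the left and top
    edges, let the prefix sums be computed by following a row or a column. *)
Lemma linked_draws P : linked P -> draws (tiling_mx P) P.
Proof.
case=> next prev.
have signE i j : tiling_mx P i j = tile_sign (P i j) by rewrite mxE.
have left0 (i j : 'I_n) : j = 0 :> nat -> enters (P i j) Left = false.
  move=> j0; apply/negP => /entersP[e segt].
  have [/andP[_ //]|[[[i' j'] [d []]] _ //]] := prev ((i, j), (Left, e)) segt.
  by rewrite /followed_by /= j0 andbF.
have top0 (i j : 'I_n) : i = 0 :> nat -> exits (P i j) Top = false.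
  move=> i0; apply/negP => /exitsP[d segs].
  have [/andP[_ //]|[[[i' j'] [[] e]] _ //]] := next ((i, j), (d, Top)) segs.
  by rewrite /followed_by /= i0.
have leftS (i j j' : 'I_n) : j' = j.+1 :> nat ->
    enters (P i j') Left = exits (P i j) Right.
  move=> jj'; apply/entersP/exitsP => -[d seg].
  + have [/andP[_ //]|[[[a b] [e []]] //]] := prev ((i, j'), (Left, d)) seg.
    rewrite /segment_of /followed_by /= jj' eqSS => segs /andP[/eqP-> /eqP bj].
    by exists e; rewrite (val_inj bj).
  + have [|[[[a b] [[] e]] //]] := next ((i, j), (d, Right)) seg.
      by rewrite /exits_at_right_edge /= -jj' ltn_eqF.
    rewrite /segment_of /followed_by /= -jj' => segs /andP[/eqP<- /eqP bj].
    by exists e; rewrite -(val_inj bj).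
have topS (i i' j : 'I_n) : i' = i.+1 :> nat ->
    exits (P i' j) Top = enters (P i j) Bottom.
  move=> ii'; apply/exitsP/entersP => -[d seg].
  + have [/andP[_ //]|[[[a b] [[] e]] //]] := next ((i', j), (d, Top)) seg.
    rewrite /segment_of /followed_by /= ii' eqSS => segs /andP[/eqP ai /eqP<-].
    by exists e; rewrite (val_inj ai).
  + have [|[[[a b] [e []]] //]] := prev ((i, j), (Bottom, d)) seg.
      by rewrite /starts_at_bottom_edge /= -ii' ltn_eqF.
    rewrite /segment_of /followed_by /= -ii' => segs /andP[/eqP ai /eqP->].
    by exists e; rewrite -(val_inj ai).
have leftE (i : 'I_n) m (j : 'I_n) : j = m :> nat ->
    (enters (P i j) Left)%:Z = row_prefix (tiling_mx P) i j.
  elim: m j => [|m IHm] j jm; first by rewrite left0 // jm row_prefix0.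
  have lmn : (m < n)%N by rewrite ltnW // -jm.
  rewrite (leftS i (Ordinal lmn)) // tile_sign_row IHm // -signE -row_prefixS.
  by rewrite jm.
have topE (j : 'I_n) m (i : 'I_n) : i = m :> nat ->
    (exits (P i j) Top)%:Z = col_prefix (tiling_mx P) j i.
  elim: m i => [|m IHm] i im; first by rewrite top0 // im col_prefix0.
  have lmn : (m < n)%N by rewrite ltnW // -im.
  rewrite (topS (Ordinal lmn)) // tile_sign_col IHm // -signE -col_prefixS.
  by rewrite im.
move=> i j; split.
- exact: leftE.
- by rewrite tile_sign_row (leftE i j) // row_prefixS signE.
- exact: topE.
- by rewrite tile_sign_col (topE j i) // col_prefixS signE.
Qed.

(** * Bumpless pipe dreams as drawn tilings *)

Lemma path_pred (T : eqType) (e : rel T) x p y : path e x p -> y \in x :: p ->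
  y = x \/ exists2 z, z \in x :: p & e z y.
Proof.
elim: p x => [|z p IHp] x /=; first by rewrite inE => _ /eqP; left.
case/andP=> exz pzp; rewrite inE => /predU1P[-> | yzp]; first by left.
right; have [->|[w wzp ewy]] := IHp z pzp yzp.
  by exists x; rewrite ?mem_head.
by exists w; rewrite // inE wzp orbT.
Qed.

Lemma path_succ (T : eqType) (e : rel T) x p y : path e x p -> y \in x :: p ->
  y = last x p \/ exists2 z, z \in x :: p & e y z.
Proof.
elim: p x => [|z p IHp] x /=; first by rewrite inE => _ /eqP; left.
case/andP=> exz pzp; rewrite inE => /predU1P[-> | yzp]; first right.
  by exists z; rewrite // !inE eqxx orbT.
have [->|[w wzp ewy]] := IHp z pzp yzp; first by left.
by right; exists w; rewrite // inE wzp orbT.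
Qed.

Lemma bpd_linked P : is_bpd P -> linked P.
Proof.
case=> p [pipeP coverP]; split=> s segP.
- have [k [sk _]] := coverP s segP; have := pipeP k; rewrite /is_pipe.
  case: (p k) sk => // x q sxq /and4P[/allP allq pathq _ exq].
  have [->|[t tq st]] := path_succ pathq sxq; first by left.
  by right; exists t => //; exact: allq.
- have [k [sk _]] := coverP s segP; have := pipeP k; rewrite /is_pipe.
  case: (p k) sk => // x q sxq /and4P[/allP allq pathq stq _].
  have [->|[t tq ts]] := path_pred pathq sxq; first by left.
  by right; exists t => //; exact: allq.
Qed.

Lemma bpd_draws P : is_bpd P -> draws (tiling_mx P) P.
Proof. by move/bpd_linked/linked_draws. Qed.

(** Pipes go up and right, so this counter grows by one along a pipe; it is the
    measure of the inductions that follow pipes forwards or backwards. *)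
Definition height s : nat := (s.1.2 + (n - s.1.1))%N.

Lemma followed_by_height s t : followed_by s t -> height t = (height s).+1.
Proof.
case: s t => [[i j] [d e]] [[i' j'] [d' e']]; rewrite /followed_by /height /=.
case: e d' => - [] // /andP[].
- by move=> /eqP-> /eqP->.
- by move=> /eqP ii' /eqP->; have := ltn_ord i; lia.
Qed.

Lemma height_max s : (height s < n + n)%N.
Proof. by case: s => [[i j] ?]; rewrite /height /=; have := ltn_ord j; lia. Qed.

Lemma followed_by_fun P s t t' : segment_of P t -> segment_of P t' ->
  followed_by s t -> followed_by s t' -> t = t'.
Proof.
case: s t t' => [[i j] [d e]] [[a b] [f g]] [[a' b'] [f' g']].
rewrite /segment_of /followed_by /= => segt segt'.
case: e f f' segt segt' => - [] // [] // segt segt'.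
- move=> /andP[/eqP ai /eqP bj] /andP[/eqP ai' /eqP bj'].
  have bb' : b = b' by apply: val_inj; rewrite /= bj.
  by subst; rewrite (exit_fun segt segt').
- move=> /andP[/eqP ai /eqP bj] /andP[/eqP ai' /eqP bj'].
  have aa' : a = a' by apply: val_inj; apply: succn_inj; rewrite /= -ai.
  by subst; rewrite (exit_fun segt segt').
Qed.

Lemma followed_by_inj P s s' t : segment_of P s -> segment_of P s' ->
  followed_by s t -> followed_by s' t -> s = s'.
Proof.
case: t s s' => [[i j] [d e]] [[a b] [f g]] [[a' b'] [f' g']].
rewrite /segment_of /followed_by /= => segs segs'.
case: g g' d segs segs' => - [] // [] // segs segs'.
- move=> /andP[/eqP ai /eqP bj] /andP[/eqP ai' /eqP bj'].
  have bb' : b = b' by apply: val_inj; apply: succn_inj; rewrite /= -bj.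
  by subst; rewrite (entry_fun segs segs').
- move=> /andP[/eqP ai /eqP bj] /andP[/eqP ai' /eqP bj'].
  have aa' : a = a' by apply: val_inj; rewrite /= ai.
  by subst; rewrite (entry_fun segs segs').
Qed.

Lemma starts_not_followed s t : followed_by s t -> ~~ starts_at_bottom_edge t.
Proof.
case: s t => [[i j] [d e]] [[a b] [f g]]; rewrite /followed_by.
rewrite /starts_at_bottom_edge /= [X in ~~ X]andbC.
by case: e f => - [] //= /andP[/eqP<- _]; rewrite ltn_eqF.
Qed.

Lemma exits_not_followed s t : followed_by s t -> ~~ exits_at_right_edge s.
Proof.
case: s t => [[i j] [d e]] [[a b] [f g]]; rewrite /followed_by.
rewrite /exits_at_right_edge /= [X in ~~ X]andbC.
by case: e f => - [] //= /andP[_ /eqP<-]; rewrite ltn_eqF.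
Qed.

Lemma start_fun P s t : segment_of P s -> segment_of P t ->
  starts_at_bottom_edge s -> starts_at_bottom_edge t -> s.1.2 = t.1.2 -> s = t.
Proof.
case: s t => [[i j] [d e]] [[a b] [f g]].
rewrite /segment_of /starts_at_bottom_edge /= => segs segt.
move=> /andP[/eqP iN /eqP dB] /andP[/eqP aN /eqP fB] jb.
have ia : i = a by apply: val_inj; apply: succn_inj; rewrite /= iN.
by subst; rewrite (exit_fun segs segt).
Qed.

Lemma is_pipe_cons P s q :
  is_pipe P (s :: q) = [&& all (segment_of P) (s :: q),
    path (@followed_by n) s q, starts_at_bottom_edge s
    & exits_at_right_edge (last s q)].
Proof. by []. Qed.

Lemma linked_walk P s : linked P -> segment_of P s ->
  exists q, [&& all (segment_of P) (s :: q), path (@followed_by n) s q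
              & exits_at_right_edge (last s q)].
Proof.
move=> [next _]; have [m] := ubnP (n + n - height s).
elim: m s => // m IHm s ltm segs.
have [exs|[t segt st]] := next s segs; first by exists [::]; rewrite /= segs exs.
have [|q /and3P[allq pathq exq]] := IHm t _ segt.
  by have := height_max s; rewrite (followed_by_height st); lia.
by exists (t :: q); rewrite /= segs st exq pathq; move: allq => /= ->.
Qed.

(** One pipe is started in each bottom cell, where the column sums 1 of A provide
    a segment.  Tracing a segment backwards leads to the bottom edge, hence to
    one of these pipes; as origins are unique, it leads to only one. *)
Lemma asm_draws_bpd A P : is_asm A -> draws A P -> is_bpd P.
Proof.
move=> hA drawP; have linkP := draws_linked drawP.
have /fin_all_exists[p pP] : forall k : 'I_n, exists p,
    is_pipe P p /\ exists s q, p = s :: q /\ s.1.2 = k.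
  move=> k; have lastn : (n.-1 < n)%N.
    by rewrite prednK // (leq_ltn_trans _ (ltn_ord k)).
  have [_ _ _ hB] := drawP (Ordinal lastn) k.
  have /entersP[e segs] : enters (P (Ordinal lastn) k) Bottom.
    move: hB; rewrite /= prednK ?asm_col_total //.
      by case: (enters _ _).
    exact: leq_ltn_trans lastn.
  have [q /and3P[allq pathq exq]] :=
    linked_walk linkP (s := ((Ordinal lastn, k), (Bottom, e))) segs.
  exists ((Ordinal lastn, k, (Bottom, e)) :: q); split; last by do 2!eexists.
  rewrite /is_pipe allq pathq exq /starts_at_bottom_edge /= !andbT.
  by rewrite prednK // (leq_ltn_trans _ lastn).
exists p; split=> [k|]; first by case: (pP k).
have memP k s : s \in p k -> segment_of P s /\
    (starts_at_bottom_edge s /\ s.1.2 = k \/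
      exists2 s', s' \in p k & followed_by s' s).
  have [pipek [x [q [eqk xk]]]] := pP k.
  move: pipek; rewrite eqk is_pipe_cons => /and4P[/allP allq pathq stx _] sk.
  split; first exact: allq.
  by have [->|] := path_pred pathq sk; [left | right].
have succP k s t : s \in p k -> segment_of P t -> followed_by s t -> t \in p k.
  have [pipek [x [q [eqk xk]]]] := pP k.
  move: pipek; rewrite eqk is_pipe_cons.
  move=> /and4P[/allP allq pathq _ exq] sk segt st.
  have [sl|[t' t'k st']] := path_succ pathq sk.
    by have := exits_not_followed st; rewrite sl exq.
  by rewrite (followed_by_fun segt (allq _ t'k) st st').
move=> s segs; have [m] := ubnP (height s).
elim: m s segs => // m IHm s segs ltm.
have [sts|[s' segs' ss']] := linkP.2 s segs.
  exists s.1.2; split=> [|k sk].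
    have [pipek [x [q [eqk xk]]]] := pP s.1.2.
    move: pipek; rewrite eqk is_pipe_cons => /and4P[/allP allq _ stx _].
    rewrite (start_fun (allq _ (mem_head x q)) segs stx sts xk).
    exact: mem_head.
  have [_ [[_ ->//]|[s' _ ss']]] := memP k s sk.
  by have := starts_not_followed ss'; rewrite sts.
have [|k [s'k uniqk]] := IHm s' segs'.
  by rewrite -ltnS -(followed_by_height ss').
exists k; split=> [|k' sk']; first exact: succP s'k segs ss'.
apply: uniqk; have [_ [[sts _]|[s'' s''k' s''s]]] := memP k' s sk'.
  by have := starts_not_followed ss'; rewrite sts.
have [segs'' _] := memP k' s'' s''k'.
by rewrite (followed_by_inj segs' segs'' ss' s''s).
Qed.

(** * Local moves as drops of a corner sum *)

Lemma Phi_draws A : is_asm A -> draws A (Phi A).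
Proof.
move=> hA; have [P drawP] := asm_draws_exists hA.
rewrite /Phi; set Q := (fun P : tiling n => _).
have [] : Q (epsilon (inhabits (const_mx Blank)) Q).
  apply: epsilon_spec; exists P; split; first exact: asm_draws_bpd drawP.
  exact: draws_tiling_mx.
by move=> /bpd_draws; move=> + <-.
Qed.

(** Lowering rk at (x0 + 1, y0 + 1) changes exactly the prefix sums read on the
    four edges at this lattice point: those to its left and above it drop
    from 1 to 0, those to its right and below it rise from 0 to 1.  These are the
    inner edges of the 2 x 2 block, and since every other side is kept, each
    tile has two possibilities, which the move lists. *)
Lemma draws_local_move A B P Q : draws A P -> draws B Q ->
  local_move Q P <-> exists x0 y0,
    [/\ (x0.+1 < n)%N, (y0.+1 < n)%N & rk_drop B A x0.+1 y0.+1].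
Proof.
move=> drawP drawQ; split.
- case=> i [i' [j [j' [ii' jj' [mTL mTR mBL mBR] away]]]].
  exists i, j; split; [by rewrite -ii' | by rewrite -jj' |].
  have rowE (a : 'I_n) y : (y <= n)%N -> row_prefix A a y = row_prefix B a y
      - ((a == i) && (y == j.+1))%:Z + ((a == i') && (y == j.+1))%:Z.
    case: y => [|y] lyn; first by rewrite !row_prefix0 !andbF.
    have [b -> {y lyn}] : exists b : 'I_n, y = b by exists (Ordinal lyn).
    have [_ rP _ _] := drawP a b; have [_ rQ _ _] := drawQ a b.
    rewrite -rP -rQ eqSS {rP rQ}.
    have [->|ai] := eqVneq a i.
      have -> : (i == i') = false by apply/eqP => e; move: ii'; rewrite -e; lia.
      have [->|bj] := eqVneq b j; first by rewrite eqxx; case: mTL.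
      have -> : (b == j :> nat) = false by apply/negbTE.
      have [->|bj'] := eqVneq b j'; first by case: mTR.
      by rewrite away ?subr0 ?addr0 // !inE (negPf bj) (negPf bj') andbF.
    have [->|ai'] := eqVneq a i'.
      have [->|bj] := eqVneq b j; first by rewrite eqxx; case: mBL.
      have -> : (b == j :> nat) = false by apply/negbTE.
      have [->|bj'] := eqVneq b j'; first by case: mBR.
      by rewrite away ?subr0 ?addr0 // !inE (negPf bj) (negPf bj') andbF.
    by rewrite away ?subr0 ?addr0 // !inE (negPf ai) (negPf ai').
  elim=> [|x IHx] y lxn lyn; first by rewrite !rk0x subr0.
  have := rkSx A (Ordinal lxn) y; have := rkSx B (Ordinal lxn) y.
  have := rowE (Ordinal lxn) y lyn; have := IHx y (ltnW lxn) lyn.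
  by rewrite -!val_eqE /= ii' eqSS; lia.
- case=> x0 [y0 [lx0n ly0n dropBA]].
  pose i := Ordinal (ltnW lx0n); pose i' := Ordinal lx0n.
  pose j := Ordinal (ltnW ly0n); pose j' := Ordinal ly0n.
  have rowE (a : 'I_n) y : (y <= n)%N -> row_prefix A a y = row_prefix B a y
      - ((a == i) && (y == y0.+1))%:Z + ((a == i') && (y == y0.+1))%:Z.
    move=> lyn; have := rkSx A a y; have := rkSx B a y.
    rewrite !dropBA // 1?ltnW // -!val_eqE /= eqSS; lia.
  have colE (b : 'I_n) x : (x <= n)%N -> col_prefix A b x = col_prefix B b x
      - ((b == j) && (x == x0.+1))%:Z + ((b == j') && (x == x0.+1))%:Z.
    move=> lxn; have := rkxS A x b; have := rkxS B x b.
    rewrite !dropBA // 1?ltnW // -!val_eqE /= eqSS; lia.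
  have sides a b : [/\
    (enters (P a b) Left)%:Z = (enters (Q a b) Left)%:Z
      - ((a == i) && (b == j'))%:Z + ((a == i') && (b == j'))%:Z,
    (exits (P a b) Right)%:Z = (exits (Q a b) Right)%:Z
      - ((a == i) && (b == j))%:Z + ((a == i') && (b == j))%:Z,
    (exits (P a b) Top)%:Z = (exits (Q a b) Top)%:Z
      - ((b == j) && (a == i'))%:Z + ((b == j') && (a == i'))%:Z &
    (enters (P a b) Bottom)%:Z = (enters (Q a b) Bottom)%:Z
      - ((b == j) && (a == i))%:Z + ((b == j') && (a == i))%:Z].
    have [-> -> -> ->] := drawP a b; have [-> -> -> ->] := drawQ a b.
    by split; rewrite ?rowE ?colE // ltnW.
  have ni : (i == i') = false by rewrite -val_eqE /=; lia.
  have nj : (j == j') = false by rewrite -val_eqE /=; lia.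
  have ni' : (i' == i) = false by rewrite eq_sym.
  have nj' : (j' == j) = false by rewrite eq_sym.
  exists i, i', j, j'; split=> //.
    split.
    + have := sides i j; rewrite !eqxx ni nj /=.
      by case: (P i j) (Q i j) => - [] [] //; constructor.
    + have := sides i j'; rewrite !eqxx ni nj' /=.
      by case: (P i j') (Q i j') => - [] [] //; constructor.
    + have := sides i' j; rewrite !eqxx ni' nj /=.
      by case: (P i' j) (Q i' j) => - [] [] //; constructor.
    + have := sides i' j'; rewrite !eqxx ni' nj' /=.
      by case: (P i' j') (Q i' j') => - [] [] //; constructor.
  move=> a b; rewrite !inE; have := sides a b.
  case: (P a b) (Q a b) => - [] // sidesab /nandP[]/norP[/negPf n1 /negPf n2];
    by case: sidesab; rewrite n1 n2 ?andbF.
Qed.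

End Tilings.

Theorem proposition5p1 (n : nat) (A B : 'M[int]_n)
  (hA : is_asm A) (hB : is_asm B) :
  covers A B <-> local_move (Phi B) (Phi A).
Proof.
apply: (iff_trans (covers_rk_drop hA hB)).
exact: iff_sym (draws_local_move (Phi_draws hA) (Phi_draws hB)).
Qed.
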